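(* Let $C_{m,3}$ be a $3$-uniform linear hypercycle with $m\ge 6$ hyperedges. Let $m=3a+b$, where $a\ge 2$ and $0\le b\le 2$ are integers. Then $\lambda(C_{m,3})=2a+b$.
   Context: A hypergraph $H$ is a pair $(V(H),E(H))$ with $V(H)$ a finite set and $E(H)$ a finite family of non-empty subsets of $V(H)$ (hyperedges) whose union is $V(H)$. Standing assumption: all hypergraphs are connected and Sperner (no hyperedge is a subset of another hyperedge). $H$ is $3$-uniform if every hyperedge has exactly $3$ elements, and linear if $|E_i\cap E_j|\le 1$ for distinct hyperedges $E_i,E_j$. $H$ is a hypercycle if its hyperedges can be ordered as a sequence $E_1,\ldots,E_m$ such that, for $i\neq j$, $E_i\cap E_j\ne\emptyset$ if and only if $|i-j|=1 \pmod m$, i.e. $E_i$ and $E_j$ are cyclically consecutive. For a vertex $u$, $N(u)$ is the set of vertices $v\ne u$ such that some hyperedge contains both $u$ and $v$. A set $S\subseteq V(H)$ is locating-dominating if for any two distinct $u,v\in V(H)-S$, $N(u)\cap S\neq N(v)\cap S$, and $N(u)\cap S\ne\emptyset$ for every $u\in V(H)-S$. $\lambda(H)$ is the minimum cardinality of a locating-dominating set of $H$. *)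

(* Defs.v *)
From mathcomp Require Import all_boot.

Set Implicit Arguments.
Unset Strict Implicit.
Unset Printing Implicit Defensive.

Record hypergraph := Hypergraph {
  vertex :> finType;
  hedges : {set {set vertex}};
  hedges_neq0 : set0 \notin hedges;
  hedges_cover : cover hedges = [set: vertex]
}.

Section Hypergraph.
Variable H : hypergraph.
Implicit Types (u v : H) (S : {set H}).

Definition neighborhood u : {set H} :=
  [set v | (v != u) && [exists E in hedges H, (u \in E) && (v \in E)]].

Definition connected : bool :=
  [forall u : H, forall v : H, connect [rel x y | y \in neighborhood x] u v].

Definition sperner : bool :=
  [forall E in hedges H, forall F in hedges H, (E \subset F) ==> (E == F)].

Definition uniform (k : nat) : bool :=
  [forall E in hedges H, #|E| == k].

Definition linear : bool :=
  [forall E in hedges H, forall F in hedges H, (E != F) ==> (#|E :&: F| <= 1)].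

(* For i, j < m: |i - j| = 1 (mod m) up to sign, so that the last and the
   first indices, with |i - j| = m - 1, are also consecutive. *)
Definition cyc_consecutive (m i j : nat) : bool :=
  (i.+1 %% m == j) || (j.+1 %% m == i).

(* The hyperedges are numbered from 0. *)
Definition hypercycle : Prop :=
  exists2 s : seq {set H}, perm_eq s (enum (hedges H)) &
    forall i j : nat, i < size s -> j < size s -> i != j ->
      (nth set0 s i :&: nth set0 s j != set0) = cyc_consecutive (size s) i j.

Definition locating_dominating S : bool :=
  [forall u in ~: S, forall v in ~: S,
     (u != v) ==> (neighborhood u :&: S != neighborhood v :&: S)]
  && [forall u in ~: S, neighborhood u :&: S != set0].

(* The default value [set: H] of the arg min is locating-dominating. *)
Definition ld_number : nat :=
  #|[arg min_(S < [set: H] | locating_dominating S) #|S|]|.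

End Hypergraph.

(* Main.v *)
Require Import Defs.
From mathcomp Require Import all_boot zify.

Set Implicit Arguments.
Unset Strict Implicit.
Unset Printing Implicit Defensive.

(** In a 3-uniform linear hypercycle with n >= 4 hyperedges, consecutive
    hyperedges share exactly one vertex, a joint, and no vertex lies in three
    hyperedges. Hence each hyperedge consists of two consecutive joints c_i,
    c_(i+1) and one private vertex p_i, and these 2n vertices are pairwise
    distinct. Moreover N(p_i) = {c_i, c_(i+1)}, and two joints are adjacent
    exactly when they are consecutive ([hypercycle_labelling]).

    Lower bound. Let S be locating-dominating. Each p_i outside S has a trace
    N(p_i) :&: S of one or two joints, and distinct such p_i have distinct
    traces. Each joint of S is therefore the whole trace of at most one p_i, so
    there are at most |C| singleton traces, where C is the set of joints in S.
    As each joint lies in at most two traces, the number of singleton traces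
    plus twice the number of other traces is at most 2|C|. Adding the two
    bounds, twice the number of p_i outside S is at most 3|C|, whence
    2n <= 3|C| + 2(|S| - |C|) <= 3|S|
    ([locating_dominating_card_lower_bound]).

    Upper bound. The joints c_i with i %% 3 != 2 form a locating-dominating
    set, because any two omitted joints are at cyclic distance at least 3
    ([locating_dominating_joints_mod3]). When n = 3a + b this set has 2a + b
    elements, which is the ceiling of 2n / 3. *)

(** * Rotation of the indices *)

Lemma val_iter_ordS n k (i : 'I_n) : iter k (@ordS n) i = (i + k) %% n :> nat.
Proof.
elim: k => [|k IHk] /=; first by rewrite addn0 modn_small.
by rewrite IHk -addn1 modnDml addn1 addnS.
Qed.

Lemma iter_ordS_neq n k (i : 'I_n) : 0 < k < n -> iter k (@ordS n) i != i.
Proof.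
move=> /andP[k_gt0 ltkn]; apply/eqP => /(congr1 val) /=.
rewrite val_iter_ordS -[RHS](modn_small (ltn_ord i)) -[in RHS](addn0 i).
by move/eqP; rewrite eqn_modDl mod0n modn_small // (gtn_eqF k_gt0).
Qed.

Lemma ordS_val n (i : 'I_n) : val (ordS i) = if i.+1 == n then 0 else i.+1.
Proof.
rewrite /=; case: eqP => [->|neq]; first by rewrite modnn.
by rewrite modn_small //; have := ltn_ord i; lia.
Qed.

(** * Joints and private vertices of a hypercycle *)

(** The intended hyperedges are the sets {c i, p i, c (ordS i)}; they enter the
    two bounds only through the adjacencies that involve a joint. *)
Record cycle_labelling (H : hypergraph) n (c p : 'I_n -> H) : Prop := {
  joint_inj : injective c;
  private_inj : injective p;
  joint_neq_private : forall i j, c i != p j;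
  label_surj : forall u, exists i, u = c i \/ u = p i;
  neighborhood_private : forall i, neighborhood (p i) = [set c i; c (ordS i)];
  joint_adjacent : forall i j,
    (c j \in neighborhood (c i)) = (ordS i == j) || (ordS j == i)
}.

Lemma hypercycle_enum (H : hypergraph) : hypercycle H ->
  exists E : 'I_#|hedges H| -> {set H},
  [/\ injective E, forall F, F \in hedges H <-> exists i, F = E i &
      forall i j, i != j ->
        (E i :&: E j != set0) = (ordS i == j) || (ordS j == i)].
Proof.
case=> s s_perm s_cyc.
have sz_s : size s = #|hedges H| by rewrite (perm_size s_perm) cardE.
have mem_s F : (F \in s) = (F \in hedges H).
  by rewrite (perm_mem s_perm) mem_enum.
have uniq_s : uniq s by rewrite (perm_uniq s_perm) enum_uniq.
exists (fun i => nth set0 s i); split=> [i j /eqP|F|i j neq_ij].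
- by rewrite nth_uniq ?sz_s // => /eqP/val_inj.
- rewrite -mem_s; split=> [/(nthP set0)[k ltk <-]|[i ->]].
    by rewrite sz_s in ltk; exists (Ordinal ltk).
  by rewrite mem_nth ?sz_s.
- by rewrite s_cyc ?sz_s.
Qed.

(** If E 0, ..., E n.-1 is the cyclic order, the joint d i is taken in
    E i :&: E (ordS i), so that the hyperedge carrying the private vertex p i is
    E (ordS i). Since n >= 4, the two cyclic neighbors of a hyperedge are
    disjoint, which is why no vertex belongs to three hyperedges. *)
Lemma hypercycle_labelling (H : hypergraph) :
    uniform H 3 -> linear H -> hypercycle H -> 4 <= #|hedges H| ->
  exists c p : 'I_#|hedges H| -> H, cycle_labelling c p.
Proof.
move=> /forall_inP H3 /forall_inP Hlin /hypercycle_enum[E [E_inj edgeP EI]].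
move: #|hedges H| E E_inj edgeP EI => n E E_inj edgeP EI n_ge4.
have EH i : E i \in hedges H by apply/edgeP; exists i.
have S1 (i : 'I_n) : ordS i != i by apply: (@iter_ordS_neq _ 1); lia.
have S2 (i : 'I_n) : ordS (ordS i) != i by apply: (@iter_ordS_neq _ 2); lia.
have S3 (i : 'I_n) : ordS (ordS (ordS i)) != i.
  by apply: (@iter_ordS_neq _ 3); lia.
have capE i : exists x, E i :&: E (ordS i) == [set x].
  suff /cards1P[x ->] : #|E i :&: E (ordS i)| == 1 by exists x.
  rewrite eqn_leq card_gt0 EI ?eqxx 1?eq_sym // andbT.
  have /forall_inP/(_ _ (EH (ordS i)))/implyP-> // := Hlin _ (EH i).
  by rewrite (inj_eq E_inj) eq_sym.
pose d i := xchoose (capE i).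
have dE i : E i :&: E (ordS i) = [set d i] by apply/eqP/(xchooseP (capE i)).
have dP i u : (u \in E i) && (u \in E (ordS i)) = (u == d i).
  by rewrite -in_setI dE inE.
have meet i j u : u \in E i -> u \in E j -> [\/ i = j, ordS i = j | ordS j = i].
  move=> ui uj; have [->|neq] := eqVneq i j; first by constructor 1.
  have : E i :&: E j != set0 by apply/set0Pn; exists u; rewrite inE ui.
  by rewrite EI // => /orP[]/eqP; [constructor 2 | constructor 3].
have d_in i : (d i \in E i) && (d i \in E (ordS i)) by rewrite dP.
have d_edge i j : (d i \in E j) = (j == i) || (j == ordS i).
  have /andP[di dSi] := d_in i.
  apply/idP/orP => [dj|[/eqP->|/eqP->]] //.
  have [->|eSij|eSji] := meet _ _ _ di dj; [by left | by right; rewrite eSij|].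
  have [->|eSSij|eSj] := meet _ _ _ dSi dj; first by right.
    by have := S3 j; rewrite eSji eSSij eqxx.
  by left; rewrite (can_inj (@ordSK n) eSj).
have d_inj : injective d.
  move=> i j eij; have [//|neq_ij] := eqVneq i j.
  have : d j \in E i by rewrite -eij d_edge eqxx.
  rewrite d_edge (negPf neq_ij) => /eqP eiSj.
  have : d i \in E j by rewrite eij d_edge eqxx.
  rewrite d_edge eq_sym (negPf neq_ij) => /eqP eji.
  by have := S2 j; rewrite -eiSj -eji eqxx.
have privE i : exists x, (E (ordS i) :\ d i) :\ d (ordS i) == [set x].
  suff /cards1P[x ->] : #|(E (ordS i) :\ d i) :\ d (ordS i)| == 1 by exists x.
  have := cardsD1 (d i) (E (ordS i)).
  rewrite (cardsD1 (d (ordS i)) (_ :\ _)) !inE (inj_eq d_inj) S1.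
  rewrite !d_edge !eqxx orbT.
  by rewrite (eqP (H3 _ (EH _))) /= => -[->].
pose p i := xchoose (privE i).
have pP i u : (u \in E (ordS i)) = [|| u == d i, u == d (ordS i) | u == p i].
  have /eqP/setP/(_ u) := xchooseP (privE i); rewrite !inE -/(p i) => <-.
  have [->|_] := eqVneq u (d i); first by rewrite d_edge eqxx orbT.
  by have [->|_] := eqVneq u (d (ordS i)); first by rewrite d_edge eqxx.
have p_neq i : (p i != d (ordS i)) && (p i != d i).
  have /eqP/setP/(_ (p i)) := xchooseP (privE i); rewrite !inE eqxx.
  by case/and3P=> -> ->.
have p_in i : p i \in E (ordS i) by rewrite pP eqxx !orbT.
have p_edge i j : (p i \in E j) = (j == ordS i).
  apply/idP/eqP => [pj|->] //; have /andP[neqS neq] := p_neq i.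
  have [->|eSSij|eSj] // := meet _ _ _ (p_in i) pj.
    by move: neqS; rewrite -dP p_in eSSij pj.
  by move: neq; rewrite (can_inj (@ordSK n) eSj) in pj; rewrite -dP p_in pj.
have nbrP u v : reflect (v != u /\ exists i, u \in E i /\ v \in E i)
                        (v \in neighborhood u).
  rewrite inE; apply: (iffP andP) => -[neq].
    case/exists_inP=> F /edgeP[i ->] /andP[ui vi].
    by split=> //; exists i.
  by case=> i /andP uvi; split=> //; apply/exists_inP; exists (E i).
have d_neq_p i j : d i != p j.
  apply/eqP=> eij; have := p_edge j i; have := p_edge j (ordS i).
  rewrite -eij !d_edge !eqxx orbT => /esym/eqP <- /esym.
  by rewrite eq_sym (negPf (S1 i)).
exists d, p; split=> //.
- move=> i j eij; have := p_edge i (ordS j).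
  by rewrite eij p_edge eqxx => /esym/eqP/(can_inj (@ordSK n)).
- move=> u; have : u \in cover (hedges H) by rewrite hedges_cover inE.
  case/bigcupP=> _ /edgeP[i ->]; rewrite -(ord_predK i) pP.
  by case/or3P=> /eqP->; eexists; [left | left | right].
- move=> i; apply/setP=> v; apply/nbrP/idP => [[neq [j []]]|].
    rewrite p_edge => /eqP->; rewrite pP (negPf neq) orbF.
    by rewrite !inE.
  rewrite !inE => vd; split; first by case/orP: vd => /eqP->.
  by exists (ordS i); rewrite p_in pP orbA vd.
- move=> i j; apply/nbrP/idP => [[neq [k []]]|].
    rewrite (inj_eq d_inj) in neq; rewrite !d_edge.
    case/orP=> /eqP-> /orP[] // ; rewrite 1?(inj_eq (can_inj (@ordSK n)));
    by rewrite 1?[_ == j]eq_sym ?(negPf neq) // => /eqP->; rewrite eqxx ?orbT.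
  case/orP=> /eqP<-; (split; first by rewrite (inj_eq d_inj) // eq_sym).
    by exists (ordS i); rewrite !d_edge !eqxx orbT.
  by exists (ordS j); rewrite !d_edge !eqxx orbT.
Qed.

(** * Lower bound *)

Lemma sum_ordS n (F : 'I_n -> nat) : \sum_(i < n) F (ordS i) = \sum_(i < n) F i.
Proof. by rewrite [RHS](reindex_inj (can_inj (@ordSK n))). Qed.

(** Twice the number of private vertices outside S is at most three times the
    number of joints in S. This is obtained by summing two inequalities that
    hold at each index, each joint in S being counted once in [code1] and twice
    in [code2]. *)
Lemma locating_dominating_card_lower_bound (H : hypergraph) n
    (c p : 'I_n -> H) (S : {set H}) :
  1 < n -> cycle_labelling c p -> locating_dominating S -> 2 * n <= 3 * #|S|.
Proof.
move=> n_gt1 L /andP[/forall_inP Sloc /forall_inP Sdom].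
have card_in (f : 'I_n -> H) : injective f ->
    \sum_(i < n) (f i \in S) = #|f @: [set i | f i \in S]|.
  move=> f_inj; rewrite card_imset // -sum1_card [RHS]big_mkcond /=.
  by apply: eq_bigr => i _; rewrite inE; case: (f i \in S).
have cardS : \sum_(i < n) (c i \in S) + \sum_(i < n) (p i \in S) <= #|S|.
  rewrite (card_in c (joint_inj L)) (card_in p (private_inj L)) -cardsUI.
  set A := c @: _; set B := p @: _.
  have -> : A :&: B = set0.
    apply/setP=> u; rewrite !inE; apply/andP=> -[/imsetP[i _ ->] /imsetP[j _]].
    by move/eqP; rewrite (negPf (joint_neq_private L i j)).
  rewrite cards0 addn0; apply/subset_leq_card/subsetP=> u.
  by case/setUP=> /imsetP[i]; rewrite inE => ? ->.
(* The private vertex p i is outside S and its trace is the single joint c i,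
   respectively c (ordS i). *)
pose lft i := [&& p i \notin S, c i \in S & c (ordS i) \notin S].
pose rgt i := [&& p i \notin S, c i \notin S & c (ordS i) \in S].
have nbrS i : neighborhood (p i) :&: S = [set c i; c (ordS i)] :&: S.
  by rewrite (neighborhood_private L).
(* A joint cannot be the trace of both private vertices next to it, since
   these would not be separated. *)
have code1 i : lft (ordS i) + rgt i <= (c (ordS i) \in S).
  rewrite /lft /rgt; case cS: (c (ordS i) \in S); rewrite ?andbF //=.
  case: (boolP (p i \in S)) => pS; first by rewrite addn0 leq_b1.
  case pSS: (p (ordS i) \in S); first by rewrite leq_b1.
  case cSS: (c (ordS (ordS i)) \in S); first by rewrite leq_b1.
  case ci: (c i \in S) => //=.
  have := Sloc (p i); rewrite inE => /(_ pS)/forall_inP/(_ (p (ordS i))).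
  rewrite inE pSS (inj_eq (private_inj L)) eq_sym.
  rewrite (@iter_ordS_neq _ 1) ?n_gt1 //.
  move=> /(_ isT)/implyP/(_ isT)/negP[]; rewrite !nbrS.
  apply/eqP/setP=> u; rewrite !inE.
  have [uS|] := boolP (u \in S); last by rewrite !andbF.
  have -> : (u == c i) = false by apply/eqP=> eu; rewrite eu ci in uS.
  suff -> : (u == c (ordS (ordS i))) = false by rewrite orbF.
  by apply/eqP=> eu; rewrite eu cSS in uS.
(* By domination, the trace of p i outside S has at least one joint; when it
   has only one, exactly one of lft i, rgt i makes up for the other. *)
have code2 i :
    2 <= lft i + rgt i + (c i \in S) + (c (ordS i) \in S)
         + ((p i \in S) + (p i \in S)).
  rewrite /lft /rgt; case: (boolP (p i \in S)) => pS; first by rewrite leq_addl.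
  rewrite addn0; case ci: (c i \in S); case cS: (c (ordS i) \in S) => //=.
  have := Sdom (p i); rewrite inE => /(_ pS)/set0Pn[u].
  rewrite nbrS !inE => /andP[/orP[]/eqP->]; by rewrite ?ci ?cS.
have : \sum_(i < n) (lft (ordS i) + rgt i) <= \sum_(i < n) (c (ordS i) \in S).
  exact: leq_sum.
have : \sum_(i < n) 2 <= \sum_(i < n) (lft i + rgt i + (c i \in S)
                           + (c (ordS i) \in S) + ((p i \in S) + (p i \in S))).
  exact: leq_sum.
rewrite sum_nat_const card_ord !big_split /=.
rewrite !(sum_ordS (fun i => c i \in S : nat)).
rewrite !(sum_ordS (fun i => lft i : nat)).
move: cardS; set x := \sum_i (c i \in S); set q := \sum_i (p i \in S).
set l := \sum_i lft i; set r := \sum_i rgt i; move: x q l r => x q l r.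
by clear; lia.
Qed.

(** * Upper bound *)

Lemma sum_mod3_neq2 n : \sum_(i < n) (i %% 3 != 2) = 2 * (n %/ 3) + n %% 3.
Proof.
elim: n => [|n IHn]; first by rewrite big_ord0.
by rewrite big_ord_recr /= IHn; case: eqP; lia.
Qed.

(** Write T for the set of selected indices. If i is not in T, then the next two
    indices are in T, also across the seam between n.-1 and 0. So each private
    vertex has a trace of one joint or two consecutive joints, whereas an
    omitted joint has the trace {c_(i-1), c_(i+1)}. Two traces that coincide
    would force omitted joints at distance at most 2, or a cycle of length at
    most 3. *)
Lemma locating_dominating_joints_mod3 (H : hypergraph) n (c p : 'I_n -> H) :
    3 < n -> cycle_labelling c p ->
  locating_dominating (c @: [set i : 'I_n | i %% 3 != 2]).
Proof.
move=> n_gt3 L; set T := [set i : 'I_n | _]; set S := c @: T.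
have S1 (i : 'I_n) : ordS i != i by apply: (@iter_ordS_neq _ 1); lia.
have S2 (i : 'I_n) : ordS (ordS i) != i by apply: (@iter_ordS_neq _ 2); lia.
have S3 (i : 'I_n) : ordS (ordS (ordS i)) != i.
  by apply: (@iter_ordS_neq _ 3); lia.
have SI : injective (@ordS n) := can_inj (@ordSK n).
have TS i : i \notin T -> ordS i \in T.
  rewrite !inE negbK ordS_val => i2; apply/eqP; have := ltn_ord i.
  by case: eqP; lia.
have TSS i : i \notin T -> ordS (ordS i) \in T.
  rewrite !inE negbK !ordS_val => i2; apply/eqP; have := ltn_ord i.
  by do 2?case: eqP; lia.
have cS i : (c i \in S) = (i \in T) by rewrite mem_imset //; apply: joint_inj L.
have cp i j : (c j \in neighborhood (p i)) = (j == i) || (j == ordS i).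
  by rewrite (neighborhood_private L) !inE !(inj_eq (joint_inj L)).
have cc := joint_adjacent L.
(* Separating two vertices amounts to finding a selected joint that is adjacent
   to exactly one of them. *)
have sep u v k : k \in T ->
    (c k \in neighborhood u) != (c k \in neighborhood v) ->
  neighborhood u :&: S != neighborhood v :&: S.
  move=> kT; apply: contra => /eqP/setP/(_ (c k)).
  by rewrite !in_setI cS kT !andbT => ->.
have pp i j : i != j -> i \in T ->
    neighborhood (p i) :&: S != neighborhood (p j) :&: S.
  move=> neq iT.
  have [eij|neqS] := eqVneq i (ordS j); last first.
    by apply: (sep _ _ i); rewrite // !cp eqxx (negPf neq) (negPf neqS).
  subst i; have [jT|/TSS SST] := boolP (j \in T).
    apply: (sep _ _ j); first by [].
    by rewrite !cp eqxx !(eq_sym j) (negPf neq) (negPf (S2 j)).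
  apply: (sep _ _ (ordS (ordS j))); first by [].
  by rewrite !cp eqxx orbT (negPf (S2 j)) (negPf (S1 _)).
have pc i j : j \notin T ->
    neighborhood (p i) :&: S != neighborhood (c j) :&: S.
  move=> jT; have SjT := TS j jT.
  have kT : ord_pred j \in T.
    by apply: contraNT jT => /TS; rewrite ord_predK.
  move: (ord_pred j) (ord_predK j) kT => k ek kT; subst j.
  have [eki|neki] := boolP ((k == i) || (k == ordS i)); last first.
    by apply: (sep _ _ k); rewrite // cp (negPf neki) cc eqxx orbT.
  apply: (sep _ _ (ordS (ordS k))); rewrite // cp cc eqxx !(inj_eq SI).
  case/orP: eki => /eqP ek.
    by rewrite -ek (negPf (S2 _)) (negPf (S1 _)).
  by rewrite ek !(inj_eq SI) (negPf (S2 _)) (negPf (S3 _)).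
have cc_sep i j : i != j -> i \notin T -> j \notin T ->
    neighborhood (c i) :&: S != neighborhood (c j) :&: S.
  move=> neq iT jT; apply: (sep _ _ (ordS i)); first exact: TS.
  rewrite !cc eqxx /= (inj_eq SI) [j == i]eq_sym (negPf neq) /=.
  by apply/eqP=> /esym/eqP eij; rewrite -eij TSS in jT.
apply/andP; split; apply/forall_inP => u; rewrite inE => uS.
  apply/forall_inP => v; rewrite inE => vS; apply/implyP.
  have [i [eu|eu]] := label_surj L u;
    have [j [ev|ev]] := label_surj L v; subst u v.
  - by rewrite (inj_eq (joint_inj L)) => neq; apply: cc_sep; rewrite -?cS.
  - by move=> _; rewrite eq_sym; apply: pc; rewrite -cS.
  - by move=> _; apply: pc; rewrite -cS.
  - rewrite (inj_eq (private_inj L)) => neq.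
    have [iT|iT] := boolP (i \in T); first exact: pp.
    have [jT|jT] := boolP (j \in T).
      by rewrite eq_sym; apply: pp; rewrite // eq_sym.
    apply: (sep _ _ (ordS i)); first exact: TS.
    rewrite !cp eqxx orbT (inj_eq SI) (negPf neq) orbF.
    by apply/eqP=> /esym/eqP eij; rewrite -eij TS in jT.
apply/set0Pn; have [i [eu|eu]] := label_surj L u; subst u.
  by exists (c (ordS i)); rewrite inE cc eqxx cS TS // -cS.
have [iT|iT] := boolP (i \in T); first by exists (c i); rewrite inE cp eqxx cS.
by exists (c (ordS i)); rewrite inE cp eqxx orbT cS TS.
Qed.

Theorem theorem3p8 (H : hypergraph) (m a b : nat)
  (Hconn : connected H) (Hsperner : sperner H)
  (Hunif : uniform H 3) (Hlin : linear H) (Hcyc : hypercycle H)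
  (Hm : #|hedges H| = m) (Hm6 : 6 <= m)
  (Hab : m = 3 * a + b) (Ha : 2 <= a) (Hb : b <= 2) :
  ld_number H = 2 * a + b.
Proof.
have [|c [p L]] := hypercycle_labelling Hunif Hlin Hcyc; first by lia.
have n_gt3 : 3 < #|hedges H| by lia.
rewrite /ld_number; case: arg_minnP => [|S S_ld S_min].
  by apply/andP; split; apply/forall_inP => u; rewrite !inE.
have := S_min _ (locating_dominating_joints_mod3 n_gt3 L).
rewrite card_imset; last exact: joint_inj L.
have -> : #|[set i : 'I_#|hedges H| | i %% 3 != 2]| = 2 * a + b.
  rewrite -sum1_card big_mkcond /=.
  transitivity (\sum_(i < #|hedges H|) (i %% 3 != 2)).
    by apply: eq_bigr => i _; rewrite inE; case: ifP.
  by rewrite sum_mod3_neq2 Hm; lia.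
by have := locating_dominating_card_lower_bound (ltnW (ltnW n_gt3)) L S_ld; lia.
Qed.
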